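(* Let $n\ge 2$ and let $G=\langle z\mapsto e^{2\pi i/n}z\rangle\simeq\mathbb{Z}_n$. For any finite subset $\alpha$ of $\widehat{\mathbb{C}}$ with $|\alpha|\ge 4$, $\mathcal{A}_\alpha=G$ if and only if all three of the following hold: 1. $\alpha$ is a union of elements of $\{\{\infty\},\{0\}\}\cup\{C_n(z)\mid z\in\mathbb{C}^*\}$; 2. for every integer $p\ge 2$, $\alpha$ is not a union of elements of $\{\{\infty\},\{0\}\}\cup\{C_{pn}(z)\mid z\in\mathbb{C}^*\}$; 3. $\mathcal{A}_\alpha$ is not isomorphic to the icosahedral group $A_5$, the octahedral group $S_4$, the tetrahedral group $A_4$, or a dihedral group $D_k$ with $k\ge 2$.
   Context: $\widehat{\mathbb{C}}=\mathbb{C}\cup\{\infty\}$ is the Riemann sphere (identified with $S^2$), and $\mathbb{C}^*=\mathbb{C}\setminus\{0\}$. For a finite subset $\alpha$, $\mathcal{A}_\alpha$ is the group of linear fractional transformations $h$ with $h(\alpha)=\alpha$. $D_k$ is the dihedral group of order $2k$. For an integer $m\ge 2$ and $z\in\mathbb{C}^*$, $C_m(z)=\{e^{\frac{k}{m}2\pi i}z\mid k\in\mathbb{Z}\}$. *)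

(* Defs.v *)
From HB Require Import structures.
From mathcomp Require Import all_boot all_order all_algebra all_fingroup.
From mathcomp Require Import alt.
From mathcomp Require extremal.
From mathcomp Require Import boolp classical_sets functions cardinality.
From mathcomp Require Import reals trigo.
From mathcomp Require Import complex.
From mathcomp Require Import ring.

Set Implicit Arguments.
Unset Strict Implicit.
Unset Printing Implicit Defensive.

Import Order.TTheory GRing.Theory Num.Theory.

Local Open Scope classical_set_scope.
Local Open Scope ring_scope.

(* The Riemann sphere over the complex numbers R[i], with None as infinity. *)
Definition sphere (R : realType) : Type := option R[i].

HB.instance Definition _ (R : realType) := Choice.copy (sphere R) (option R[i]).

Section LinearFractional.
Variable R : realType.
Implicit Types (a b c d z w : R[i]) (f g : sphere R -> sphere R).

Definition expi (t : R) : R[i] := (cos t +i* sin t)%C.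

Lemma expi_neq0 t : expi t != 0.
Proof.
apply/negP; rewrite eq_complex /= => /andP[/eqP c0 /eqP s0].
have := cos2Dsin2 t; rewrite c0 s0 expr0n addr0 => /eqP.
by rewrite eq_sym oner_eq0.
Qed.

Definition mobius a b c d (z : sphere R) : sphere R :=
  match z with
  | Some z => if c * z + d == 0 then None else Some ((a * z + b) / (c * z + d))
  | None => if c == 0 then None else Some (a / c)
  end.

Definition is_lft f : Prop :=
  exists a b c d, a * d - b * c != 0 /\ f = mobius a b c d.

Lemma is_lft_id : is_lft id.
Proof.
exists 1, 0, 0, 1; rewrite mulr1 mul0r subr0 oner_neq0; split=> //.
apply: funext => -[z|] /=; last by rewrite eqxx.
by rewrite mul0r add0r oner_eq0 mul1r addr0 divr1.
Qed.

Lemma mobius_comp a b c d a' b' c' d' :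
    a * d - b * c != 0 -> a' * d' - b' * c' != 0 ->
  mobius a b c d \o mobius a' b' c' d' =
  mobius (a * a' + b * c') (a * b' + b * d') (c * a' + d * c') (c * b' + d * d').
Proof.
move=> D D'; apply: funext => -[z|] /=.
  set u := a' * z + b'; set v := c' * z + d'.
  have -> : (c * a' + d * c') * z + (c * b' + d * d') = c * u + d * v.
    by rewrite /u /v; ring.
  have -> : (a * a' + b * c') * z + (a * b' + b * d') = a * u + b * v.
    by rewrite /u /v; ring.
  have [v0|v0] /= := eqVneq v 0.
    rewrite v0 !mulr0 !addr0; have u0 : u != 0.
      apply: contraNneq D' => u0; apply/eqP.
      have [c0|c0] := eqVneq c' 0.
        by move: v0; rewrite /v c0 mul0r add0r => ->; rewrite !mulr0 subr0.
      apply: (mulfI c0); rewrite mulr0.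
      have -> : c' * (a' * d' - b' * c') = c' * (a' * v - c' * u).
        by rewrite /u /v; ring.
      by rewrite u0 v0 !mulr0 subrr mulr0.
    rewrite mulf_eq0 (negbTE u0) orbF; case: eqP => // /eqP c0.
    by congr Some; field; rewrite c0 u0.
  have E : c * (u / v) + d = (c * u + d * v) / v by field.
  rewrite E mulf_eq0 invr_eq0 (negbTE v0) orbF; case: eqP => // /eqP n0.
  by congr Some; field; rewrite v0 n0.
have [c0|c0] /= := eqVneq c' 0.
  have a0 : a' != 0.
    by apply: contraNneq D' => ->; rewrite c0 mul0r mulr0 subrr.
  rewrite c0 !mulr0 !addr0 mulf_eq0 (negbTE a0) orbF; case: eqP => // /eqP c1.
  by congr Some; field; rewrite c1 a0.
have E : c * (a' / c') + d = (c * a' + d * c') / c' by field.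
rewrite E mulf_eq0 invr_eq0 (negbTE c0) orbF; case: eqP => // /eqP n0.
by congr Some; field; rewrite c0 n0.
Qed.

Lemma is_lft_comp f g : is_lft f -> is_lft g -> is_lft (f \o g).
Proof.
move=> [a [b [c [d [D ->]]]]] [a' [b' [c' [d' [D' ->]]]]].
rewrite mobius_comp //; do 4 eexists; split; last by [].
have -> : (a * a' + b * c') * (c * b' + d * d')
    - (a * b' + b * d') * (c * a' + d * c')
    = (a * d - b * c) * (a' * d' - b' * c') by ring.
by rewrite mulf_neq0.
Qed.

Lemma is_lft_inv f : is_lft f -> exists2 g, is_lft g & g \o f = id.
Proof.
move=> [a [b [c [d [D ->]]]]].
have D' : d * a - (- b) * (- c) != 0 by rewrite mulrNN mulrC.
exists (mobius d (- b) (- c) a); first by exists d, (- b), (- c), a.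
rewrite mobius_comp //.
have -> : d * a + - b * c = a * d - b * c by ring.
have -> : d * b + - b * d = 0 by ring.
have -> : - c * a + a * c = 0 by ring.
have -> : - c * b + a * d = a * d - b * c by ring.
apply: funext => -[z|] /=; last by rewrite eqxx.
by rewrite mul0r add0r (negbTE D) addr0 mulrC mulKf.
Qed.

Definition lft : Type := {f : sphere R -> sphere R | `[< is_lft f >]}.

HB.instance Definition _ := Choice.on lft.

Definition mk_lft f (Lf : is_lft f) : lft := exist _ f (asboolT Lf).

Definition lft_one : lft := mk_lft is_lft_id.
Definition lft_mul (f g : lft) : lft :=
  mk_lft (is_lft_comp (asboolW (valP f)) (asboolW (valP g))).

Lemma lft_left_inverse (f : lft) : exists g : lft, lft_mul g f = lft_one.
Proof.
have [g Lg gf] := is_lft_inv (asboolW (valP f)).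
by exists (mk_lft Lg); apply: val_inj.
Qed.
Definition lft_inv (f : lft) : lft := sval (cid (lft_left_inverse f)).

Lemma lft_mulA : associative lft_mul.
Proof. by move=> f g h; apply: val_inj. Qed.
Lemma lft_mul1 : left_id lft_one lft_mul.
Proof. by move=> f; apply: val_inj. Qed.
Lemma lft_1mul : right_id lft_one lft_mul.
Proof. by move=> f; apply: val_inj. Qed.
Lemma lft_mulV : left_inverse lft_one lft_inv lft_mul.
Proof. by move=> f; rewrite /lft_inv; case: cid. Qed.
Lemma lft_Vmul : right_inverse lft_one lft_inv lft_mul.
Proof.
move=> f; rewrite -[LHS]lft_mul1.
rewrite -[X in lft_mul X _](lft_mulV (lft_inv f)) -lft_mulA.
by rewrite [X in lft_mul _ X]lft_mulA lft_mulV lft_mul1 lft_mulV.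
Qed.

HB.instance Definition _ := isGroup.Build lft
  lft_mulA lft_mul1 lft_1mul lft_mulV lft_Vmul.

Definition stab (alpha : set (sphere R)) : set lft :=
  [set h | val h @` alpha = alpha].

Lemma is_lft_scale w : w != 0 -> is_lft (omap ( *%R w)).
Proof.
move=> w0; exists w, 0, 0, 1; rewrite mulr1 mul0r subr0; split=> //.
apply: funext => -[z|] /=; last by rewrite eqxx.
by rewrite mul0r add0r oner_eq0 addr0 divr1.
Qed.

Definition rotation (n : nat) : lft :=
  mk_lft (is_lft_scale (expi_neq0 (2 * pi / n%:R))).

Definition rot_orbit (m : nat) (z : R[i]) : set (sphere R) :=
  [set Some (expi (k%:~R / m%:R * (2 * pi)) * z) | k in [set: int]].

Definition rot_blocks (m : nat) : set (set (sphere R)) :=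
  [set [set None]; [set Some 0]] `|`
  [set rot_orbit m z | z in [set z | z != 0]].

End LinearFractional.

Definition is_union_of (T : Type) (F : set (set T)) (A : set T) : Prop :=
  exists2 S, S `<=` F & A = \bigcup_(B in S) B.

Definition generated_subgroup (gT : groupType) (A : set gT) : set gT :=
  smallest [set H : set gT | group_closed (mem H)] A.

Definition iso_to (gT : groupType) (A : set gT)
    (hT : finGroupType) (H : {group hT}) : Prop :=
  exists2 f : hT -> gT,
    {in H &, {morph f : x y / (x * y)%g}} & set_bij [set` H] A f.

(* The library's dihedral_gtype is indexed by the order of the group. *)
Definition dihedral (k : nat) : {group extremal.dihedral_gtype k.*2} :=
  [group of [set: extremal.dihedral_gtype k.*2]].

(* Main.v *)
Require Import Defs.
From HB Require Import structures.
From mathcomp Require Import all_boot all_order all_algebra all_fingroup.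
From mathcomp Require Import all_solvable.
From mathcomp Require Import zify ring lra.

(** Three distinct points of the sphere determine a linear fractional
    transformation, so the stabilizer of a finite set with at least three
    points is finite.  A transformation of finite order other than the
    identity fixes exactly two points: after moving one of its fixed points
    to infinity it becomes [z |-> a * z + b], and a translation has infinite
    order ([two_fixed_points]).  The transformations of a finite group that
    fix a given point form a cyclic group, because the multiplier [a] embeds
    them into the multiplicative group of the field ([pole_stab_cyclic]).

    These two properties suffice, without any further geometry, to classify
    the finite groups of linear fractional transformations
    ([two_fixed_points_classification]).  Counting fixed points in two ways
    shows that a non-cyclic group [G] has exactly three orbits on which it
    does not act freely, and that their sizes [a], [b], [c] satisfy
    [a + b + c = #|G| + 2]; since they divide [#|G|], either one of the
    orbits has two points, or [#|G|] is 12, 24 or 60.  An orbit with two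
    points makes the group dihedral.  In the other cases the group acts
    faithfully on a small set: on an orbit of size 4, on its four Sylow
    3-subgroups, on its five Sylow 2-subgroups respectively.  The action
    identifies it with [A_4], [S_4], [A_5], as the alternating group is the
    only subgroup of index 2 of a symmetric group ([index2_Alt]).

    Now [alpha] is a union of orbits of the rotation of order [m] exactly
    when that rotation stabilizes [alpha] ([union_of_rot_blocks]).  If the
    three conditions hold, the stabilizer contains the rotation of order [n]
    and is cyclic by the classification.  A generator has the same two fixed
    points as this rotation, namely 0 and infinity, so that the whole
    stabilizer consists of multiplications by roots of unity; as it is
    finite of order [m], it is generated by the rotation of order [m], with
    [n] dividing [m], and the second condition forces [m = n].  Conversely,
    the group generated by the rotation of order [n] contains no rotation of
    order [p * n] with [p >= 2], and contains at most one involution, while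
    the groups of the third condition contain at least two. *)

Set Implicit Arguments.
Unset Strict Implicit.
Unset Printing Implicit Defensive.

(** * Faithful actions and symmetric groups *)

Section PermutationRepresentations.
Local Open Scope group_scope.

(** A subgroup [K] of index 2 is normal, and the product of two elements outside
    [K] lies in [K].  As transpositions are conjugate and generate, none of them
    is in [K]; so [K] consists of the products of an even number of them. *)
Lemma index2_Alt (T : finType) (K : {group {perm T}}) :
  1 < #|T| -> (2 * #|K|)%N = (#|T|)`! -> K :=: 'Alt_T.
Proof.
move=> T1 cK; have cS : #|[set: {perm T}]| = (#|T|)`! := card_Sym T.
have idx : #|[set: {perm T}] : K| = 2.
  have := Lagrange (subsetT K); rewrite cS -cK.
  by rewrite mulnC => /eqP; rewrite eqn_pmul2r ?cardG_gt0 // => /eqP.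
have nK : K <| [set: {perm T}] by apply: index2_normal; rewrite ?subsetT.
have memJ s t : (s ^ t \in K) = (s \in K).
  by rewrite memJ_norm ?(subsetP (normal_norm nK)) ?inE.
have memM s t : s \notin K -> (s * t \in K) = (t \notin K).
  move=> sK; case tK: (t \in K); first by rewrite groupMr // (negbTE sK).
  have : t \in K :* s^-1.
    by rewrite (rcoset_index2 (subsetT K) idx) // !inE ?groupV ?tK ?sK.
  rewrite mem_rcoset invgK -(memJ _ t) conjgE => h.
  by rewrite -!mulgA mulKg in h.
have tpermK x y : x != y -> tperm x y \notin K.
  move=> xy; apply/negP=> tK; have : [set: {perm T}] \subset K.
    rewrite -(gen_tperm x) gen_subG; apply/subsetP=> _ /imsetP[z _ ->].
    have [<-|xz] := eqVneq x z; first by rewrite tperm1.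
    rewrite tpermC -(@tpermJ_tperm _ y z x) ?(eq_sym _ x) //.
    by rewrite memJ tpermC.
  by move/subset_leq_card; rewrite cS -cK leqNgt ltn_Pmull ?cardG_gt0.
apply/setP=> s; rewrite Alt_even; have [ts -> dts] := prod_tpermP s.
elim: ts dts => [|t ts IH] /=; first by rewrite big_nil group1 odd_perm1.
case/andP=> dt dts; rewrite big_cons memM ?tpermK // IH // odd_mul_tperm.
by move: dt; rewrite /= => ->.
Qed.

Variables (aT : finGroupType) (rT : finType) (G : {group aT}).
Variables (to : {action aT &-> rT}) (S : {set rT}).
Hypotheses (actS : [acts G, on S | to]) (faith : 'C_G(S | to) = 1).

Lemma faithful_perm_rep :
  0 < #|S| -> exists f : {morphism G >-> {perm 'I_#|S|}}, 'injm f.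
Proof.
case/card_gt0P=> x0 Sx0; have actb : actby_cond G S to by exact: actS.
(* Restricted to [G], the action preserves [S] for all [a : aT]; so [t] below is
   injective in [i] even when [a] lies outside [G]. *)
pose B := <[actb]>%act.
have BS x a : x \in S -> B x a \in S.
  move=> Sx; rewrite /B /= /actby Sx /=; case: ifP => // Ga.
  by rewrite (acts_act actS).
pose t (i : 'I_#|S|) a : 'I_#|S| := enum_rank_in Sx0 (B (enum_val i) a).
have tE i a : enum_val (t i a) = B (enum_val i) a.
  by rewrite /t enum_rankK_in // BS // enum_valP.
have tA : is_action G t.
  split=> [a i j /(congr1 enum_val)|i a b Ga Gb].
    by rewrite !tE => /act_inj/enum_val_inj.
  by apply: enum_val_inj; rewrite !tE actMin.
exists [morphism of actperm (Action tA)].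
apply/subsetP=> a /morphpreP[Ga] /set1P a1.
rewrite -faith; apply/setIP; split=> //; apply/astabP=> x Sx.
have /(congr1 enum_val) :=
  congr1 (fun s : {perm _} => s (enum_rank_in Sx0 x)) a1.
by rewrite actpermE /= perm1 tE /= !enum_rankK_in // actbyE.
Qed.

Lemma faithful_isog_Sym m :
  #|S| = m -> 0 < m -> #|G| = m`! -> G \isog 'Sym_('I_m).
Proof.
move=> <- m0 cG; have [f injf] := faithful_perm_rep m0.
have <- : f @* G = 'Sym_('I_#|S|).
  apply/eqP; rewrite eqEcard subsetT /= card_injm // cG.
  by rewrite card_Sym card_ord.
exact: sub_isog.
Qed.

Lemma faithful_isog_Alt m :
  #|S| = m -> 1 < m -> (2 * #|G|)%N = m`! -> G \isog 'Alt_('I_m).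
Proof.
move=> <- m0 cG; have [f injf] := faithful_perm_rep (ltnW m0).
rewrite -(@index2_Alt _ (f @* G)%G) ?card_ord //=; first exact: sub_isog.
by rewrite card_injm.
Qed.

End PermutationRepresentations.

(** * Groups whose nontrivial elements fix two points *)

Section OrbitSizes.

Lemma proper_dvdn_leq d m : d %| m -> d < m -> (2 * d <= m)%N.
Proof. by case/dvdnP=> -[|[|k]] ->; nia. Qed.

(** With [N = p * a = q * b = r * c] the equation reads
    [1/p + 1/q + 1/r = 1 + 2/N]: it forces [p = 2], then [q = 2], which gives
    [c = 2], or [q = 3] and [r < 6]. *)
Lemma orbit_size_solutions N a b c :
  a %| N -> b %| N -> c %| N -> 0 < a < N -> 0 < b < N -> 0 < c < N ->
  c <= b <= a -> (a + b + c = N + 2)%N ->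
  [\/ c = 2, [/\ N = 12, a = 6, b = 4 & c = 4],
      [/\ N = 24, a = 12, b = 8 & c = 6]
    | [/\ N = 60, a = 30, b = 20 & c = 12]].
Proof.
case/dvdnP=> p pN /dvdnP[q qN] /dvdnP[r rN].
case/andP=> a0 aN /andP[b0 bN] /andP[c0 cN] /andP[cb ba] E.
have p2 : p = 2 by nia.
subst p; have q1 : 1 < q by nia.
have [q2|q3] : q = 2 \/ 2 < q by lia.
  by constructor 1; nia.
have {q1}q3' : q = 3 by nia.
subst q.
have [r3|[r4|[r5|r6]]] : r = 3 \/ r = 4 \/ r = 5 \/ (r < 3 \/ 5 < r) by lia.
- by constructor 2; split; lia.
- by constructor 3; split; lia.
- by constructor 4; split; lia.
by exfalso; nia.
Qed.

End OrbitSizes.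

Section TwoFixedPoints.
Local Open Scope group_scope.
Variables (gT : finGroupType) (rT : finType) (G : {group gT}).
Variable to : {action gT &-> rT}.
Hypothesis fix2 : {in G^#, forall g, #|'Fix_to[g]| = 2}.

Lemma three_fixed_eq1 g (S : {set rT}) :
  g \in G -> 2 < #|S| -> {in S, forall x, to x g = x} -> g = 1.
Proof.
move=> Gg S3 fS; apply: contraTeq S3 => g1; rewrite -leqNgt.
have <- : #|'Fix_to[g]| = 2 by apply: fix2; rewrite in_setD1 g1.
by apply/subset_leq_card/subsetP=> x /fS fx; apply/afix1P.
Qed.

Lemma faithful_on_three (S : {set rT}) : 2 < #|S| -> 'C_G(S | to) = 1.
Proof.
move=> S3; apply/eqP; rewrite -subG1; apply/subsetP=> g /setIP[Gg /astabP fS].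
by apply/set1P; apply: three_fixed_eq1 Gg S3 fS.
Qed.

Definition nonfree_orbits : {set {set rT}} :=
  [set O in orbit to G @: setT | #|O| < #|G|].

(** This is the Cauchy-Frobenius formula: the identity fixes as many points as
    there are in all the orbits, every other element fixes two, and the free
    orbits contribute 0 to the sum. *)
Lemma nonfree_orbit_count :
  \sum_(O in nonfree_orbits) (#|G| - #|O|) = (2 * #|G|.-1)%N.
Proof.
have actT : [acts G, on [set: rT] | to] by apply/actsP=> a _ x; rewrite !inE.
have leO O : O \in orbit to G @: setT -> #|O| <= #|G|.
  by case/imsetP=> x _ ->; rewrite dvdn_leq ?cardG_gt0 ?dvdn_orbit.
have -> : \sum_(O in nonfree_orbits) (#|G| - #|O|) =
          \sum_(O in orbit to G @: setT) (#|G| - #|O|).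
  rewrite [RHS](bigID (fun O : {set rT} => #|O| < #|G|)) /=.
  rewrite [X in _ = (_ + X)%N]big1 ?addn0 => [|O /andP[_]]; last lia.
  by apply: eq_bigl => O; rewrite inE.
have := Frobenius_Cauchy actT; rewrite (big_setD1 1) //= afix1 setTI.
have -> : \sum_(a in G^#) #|'Fix_([set: rT] | to)[a]| = (#|G|.-1 * 2)%N.
  rewrite (cardsD1 1 G) group1 /= -sum_nat_const; apply: eq_bigr => a Ga.
  by rewrite setTI fix2.
rewrite -(acts_sum_card_orbit actT) -sum_nat_const.
have -> : \sum_(i in orbit to G @: setT) #|G| =
   (\sum_(i in orbit to G @: setT) (#|G| - #|i|) +
    \sum_(i in orbit to G @: setT) #|i|)%N.
  rewrite -big_split /=; apply: eq_bigr => O /leO le.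
  by rewrite subnK.
by rewrite addnC => /addIn <-; rewrite mulnC.
Qed.

Lemma nonfree_orbitP O : O \in nonfree_orbits ->
  exists2 x, O = orbit to G x &
    [/\ #|O| %| #|G|, 0 < #|O| < #|G| & (2 * #|O| <= #|G|)%N].
Proof.
rewrite inE => /andP[/imsetP[x _ ->] ltO]; exists x => //.
have dO := dvdn_orbit to G x; split=> //; last exact: proper_dvdn_leq.
by rewrite ltO (dvdn_gt0 _ dO) ?cardG_gt0.
Qed.

(** A nonfree orbit contributes at least [#|G|/2] and at most [#|G| - 1] to the
    sum [2 * (#|G| - 1)] of [nonfree_orbit_count], so there are two or three of
    them.  If there are two, they are fixed points. *)
Lemma nonfree_orbit_types : 1 < #|G| ->
  (exists x, x \in 'Fix_to(G)) \/
  exists O1 O2 O3, nonfree_orbits = [set O1; O2; O3] /\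
    [\/ #|O3| = 2,
        [/\ #|G| = 12, #|O1| = 6, #|O2| = 4 & #|O3| = 4],
        [/\ #|G| = 24, #|O1| = 12, #|O2| = 8 & #|O3| = 6]
      | [/\ #|G| = 60, #|O1| = 30, #|O2| = 20 & #|O3| = 12]].
Proof.
move=> G1; set P := nonfree_orbits.
have cnt := nonfree_orbit_count; rewrite -/P in cnt.
have up : \sum_(O in P) (#|G| - #|O|) <= (#|P| * #|G|.-1)%N.
  rewrite -sum_nat_const; apply: leq_sum => O.
  by move=> /nonfree_orbitP[x _ [_ ? _]]; lia.
have lo : (#|P| * #|G| <= 2 * \sum_(O in P) (#|G| - #|O|))%N.
  rewrite big_distrr /= -sum_nat_const; apply: leq_sum.
  move=> O /nonfree_orbitP[x _ [_ _ h]].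
  by move: h; move: #|O| #|G| => o N; lia.
have : #|P| = 2 \/ #|P| = 3 by nia.
case=> cP.
  left; have /cards2P[O1 [O2 [O12 eP]]] : #|P| == 2 by rewrite cP.
  move: cnt; rewrite eP (big_setU1 O1) ?inE ?O12 //= big_set1.
  have /nonfree_orbitP[x e1 [_ b1 _]] : O1 \in P by rewrite eP !inE eqxx.
  have /nonfree_orbitP[y e2 [_ b2 _]] : O2 \in P by rewrite eP !inE eqxx orbT.
  move=> sz; exists x; apply/orbit1P/card_orbit1; rewrite -e1.
  by move: b1 b2 sz; move: #|O1| #|O2| #|G| => a b N; lia.
right.
have key O1 O2 O3 : P = [set O1; O2; O3] ->
    O1 != O2 -> O1 != O3 -> O2 != O3 -> #|O3| <= #|O2| <= #|O1| ->
  [\/ #|O3| = 2, [/\ #|G| = 12, #|O1| = 6, #|O2| = 4 & #|O3| = 4],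
      [/\ #|G| = 24, #|O1| = 12, #|O2| = 8 & #|O3| = 6]
    | [/\ #|G| = 60, #|O1| = 30, #|O2| = 20 & #|O3| = 12]].
  move=> eP n12 n13 n23 le.
  have /nonfree_orbitP[x1 _ [d1 b1 _]] : O1 \in P by rewrite eP !inE eqxx.
  have /nonfree_orbitP[x2 _ [d2 b2 _]] : O2 \in P by rewrite eP !inE eqxx orbT.
  have /nonfree_orbitP[x3 _ [d3 b3 _]] : O3 \in P by rewrite eP !inE eqxx orbT.
  apply: orbit_size_solutions => //.
  move: cnt; rewrite eP -setUA (big_setU1 O1) ?inE ?negb_or ?n12 //=.
  rewrite (big_setU1 O2) ?inE //= big_set1.
  by move: b1 b2 b3; move: #|O1| #|O2| #|O3| #|G| => a b c N; lia.
(* [key] wants the orbits by decreasing size. *)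
pose r := [rel A B : {set rT} | #|B| <= #|A|].
have := sort_sorted (_ : total r) (enum P); have := sort_uniq r (enum P).
have := size_sort r (enum P); have := mem_sort r (enum P).
rewrite enum_uniq -cardE cP.
case: (sort _ _) => [|A [|B [|C [|]]]] //= mP _.
rewrite !inE !negb_or => /andP[/andP[nAB nAC] /andP[nBC _]] srt.
have /and3P[le1 le2 _] := srt (fun A B => leq_total _ _).
have eP : P = [set A; B; C].
  by apply/setP=> O; have := mP O; rewrite mem_enum !inE -orbA => ->.
by exists A, B, C; split=> //; apply: key; rewrite ?le1 ?le2.
Qed.

Hypothesis stabC : forall x, cyclic 'C_G[x | to].

(** The stabilizer [C = <[c]>] of [x] has index 2.  An element [s] outside [C]
    exchanges the points [x], [y] of the orbit and fixes some third point, so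
    that its square fixes three points: all these elements are involutions, and
    [G] is generated by two of them, [s] and [c * s]. *)
Lemma isog_dihedral x k : #|orbit to G x| = 2 -> #|G| = k.*2 -> 1 < k ->
  G \isog [set: gsort 'D_(k.*2)].
Proof.
move=> O2 cG k1; set C := 'C_G[x | to]%G.
have cC : #|C| = k.
  by apply: double_inj; rewrite -cG -(card_orbit_stab to G x) O2 mul2n.
have sCG : C \subset G by apply: subsetIl.
have [y xy eO] : exists2 y, x != y & orbit to G x = [set x; y].
  have /cards2P[a [b [ab e]]] : #|orbit to G x| == 2 by rewrite O2.
  have := orbit_refl to G x; rewrite e => /set2P[->|->]; first by exists b.
  by exists a; rewrite 1?eq_sym // setUC.
have involution s : s \in G -> s \notin C -> #[s] = 2.
  move=> Gs; rewrite inE Gs /= => /astab1P sx.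
  have sxy : to x s = y.
    by have := mem_orbit to x Gs; rewrite eO => /set2P[|->].
  have syx : to y s = x.
    have : to y s \in orbit to G x by rewrite orbit_actr // eO set22.
    rewrite eO => /set2P[-> //|h]; case/eqP: xy.
    by apply: (act_inj to s); rewrite sxy.
  have s1 : s != 1 by apply: contra_notN sx => /eqP->; rewrite act1.
  have /card_gt0P[z /afix1P sz] : 0 < #|'Fix_to[s]|.
    by rewrite fix2 // in_setD1 s1.
  apply/prime.prime_nt_dvdP => //; first by rewrite order_eq1.
  rewrite order_dvdn; apply/eqP.
  apply: (three_fixed_eq1 (S := [set x; y; z])); first by rewrite groupX.
    have zx : z != x by apply: contra_notN sx => /eqP<-.
    have zy : z != y.
      by apply: contraNneq xy => zy; move: sz; rewrite zy syx => ->.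
    rewrite -setUA cardsU1 cardsU1 cards1 !inE negb_or xy.
    by rewrite !(eq_sym _ z) zx zy.
  move=> w; rewrite !inE -orbA expgS expg1 actM.
  by case/or3P=> /eqP->; rewrite ?sxy ?syx ?sz.
have /cyclicP[c eC] := stabC x.
have Cc : c \in C by rewrite /= eC cycle_id.
have c1 : c != 1 by rewrite -cycle_eq1 -eC -cardG_gt1 cC.
have [s Gs nCs] : exists2 s, s \in G & s \notin C.
  by apply/subsetPn; apply/negP=> /subset_leq_card; rewrite cC cG; lia.
have Gc := subsetP sCG _ Cc.
pose H := <<[set s; (c * s)%g]>>%G.
have Hs : s \in H by rewrite mem_gen ?set21.
have Hc : c \in H by rewrite -(groupMr _ Hs) mem_gen ?set22.
have sCH : C \subset H by rewrite /= eC cycle_subG.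
have eG : G :=: H.
  apply/esym/eqP; rewrite eqEcard; apply/andP; split.
    by rewrite gen_subG; apply/subsetP=> u /set2P[]->; rewrite ?groupM.
  have : C \proper H by rewrite properE sCH; apply/subsetPn; exists s.
  move/proper_card; have := cardSg sCH; rewrite cC cG => dH lH.
  by have := proper_dvdn_leq dH lH; rewrite mul2n.
rewrite -cG eG; apply: involutions_gen_dihedral.
- exact: involution.
- by apply: involution; [rewrite groupM | rewrite groupMl].
- by rewrite -{1}[s]mul1g (inj_eq (mulIg s)) eq_sym.
Qed.

Lemma isog_Alt4 x : #|G| = 12 -> #|orbit to G x| = 4 -> G \isog 'Alt_('I_4).
Proof.
move=> cG cO; have S3 : 2 < #|orbit to G x| by rewrite cO.
apply: faithful_isog_Alt cO _ _ => //; last by rewrite cG.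
  by apply: acts_orbit; apply: subsetT.
exact: faithful_on_three.
Qed.

Lemma Syl_kernel_normal p : 'C_G('Syl_p(G) | 'JG) <| G.
Proof.
rewrite /normal subsetIl normsI ?normG //.
apply: subset_trans (astab_norm _ _); exact: atrans_acts (Syl_trans _ _).
Qed.

Lemma Syl_kernel_sub p (P : {group gT}) :
  p.-Sylow(G) P -> 'C_G('Syl_p(G) | 'JG) \subset 'N_G(P).
Proof.
move=> sylP; apply: setIS; rewrite -astab1JG; apply: astabS.
by rewrite sub1set inE.
Qed.

Section LargeOrbits.
Hypothesis large : forall x, 2 < #|orbit to G x|.

(** [G] acts on the two fixed points of a generator of [K], so that the orbit of
    such a point would have at most two elements. *)
Lemma normal_cyclic_eq1 (K : {group gT}) : K <| G -> cyclic K -> K :=: 1.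
Proof.
move=> nKG /cyclicP[g eK]; rewrite eK; apply/eqP; rewrite cycle_eq1.
apply/negPn/negP=> g1.
have Gg : g \in G by rewrite (subsetP (normal_sub nKG)) // eK cycle_id.
have c2 : #|'Fix_to[g]| = 2 by rewrite fix2 // in_setD1 g1.
have actG : [acts G, on 'Fix_to(K) | to] by apply/acts_fix_norm/normal_norm.
move: actG; rewrite eK afix_cycle => actG.
have /card_gt0P[x fx] : 0 < #|'Fix_to[g]| by rewrite c2.
have := subset_leq_card (_ : orbit to G x \subset 'Fix_to[g]).
by rewrite acts_sub_orbit // fx c2 leqNgt large => /(_ isT).
Qed.

Lemma normal_lt4_eq1 (K : {group gT}) : K <| G -> #|K| < 4 -> K :=: 1.
Proof.
move=> nK K4; apply: normal_cyclic_eq1 => //.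
have := cardG_gt0 K; case cK: #|K| K4 => [|[|[|[|]]]] //= _ _.
- by rewrite (card1_trivg cK) cyclic1.
- by apply: prime_cyclic; rewrite cK.
- by apply: prime_cyclic; rewrite cK.
Qed.

(** The Sylow 3-subgroups are not normal, so there are four of them.  The kernel
    of the action on them lies in normalizers of order 6, and cannot have order
    6: otherwise it would contain a Sylow 3-subgroup as a characteristic
    subgroup, which would be normal in [G]. *)
Lemma isog_Sym4 : #|G| = 24 -> G \isog 'Sym_('I_4).
Proof.
move=> cG; have [P sylP] := Sylow_exists 3 G.
have cP : #|P| = 3 by rewrite (card_Hall sylP) cG p_part.
have sPG := pHall_sub sylP.
have nP : ~~ (P <| G).
  apply/negP=> nP; have := normal_lt4_eq1 nP; rewrite cP => /(_ isT) P1.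
  by rewrite P1 cards1 in cP.
have cS : #|'Syl_3(G)| = 4.
  have := card_Syl_dvd 3 G; have := card_Syl_mod G (isT : prime 3).
  have : #|'Syl_3(G)| != 1%N.
    apply: contra nP; rewrite (card_Syl sylP) indexg_eq1 subsetI => /andP[_ nP].
    by rewrite /normal sPG.
  rewrite cG; move: #|_| => n n1 n3 dn.
  have : n \in divisors 24 by rewrite -dvdn_divisors.
  by rewrite /= !inE; lia.
have cN : #|'N_G(P)| = 6.
  apply/eqP; rewrite -(eqn_pmul2r (isT : 0 < 4)) -[X in (_ * X == _)%N]cS.
  by rewrite (card_Syl sylP) Lagrange ?subsetIl // cG.
have kerE : 'C_G('Syl_3(G) | 'JG) = 1.
  pose K := 'C_G('Syl_3(G) | 'JG)%G; suff: K :=: 1 by [].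
  have nK : K <| G := Syl_kernel_normal 3.
  have sK : K \subset 'N_G(P) := Syl_kernel_sub sylP.
  have dK : #|K| %| 6 by rewrite -cN cardSg.
  have [K4|K4] := ltnP #|K| 4; first exact: normal_lt4_eq1.
  have cK : #|K| = 6.
    have : #|K| \in divisors 6 by rewrite -dvdn_divisors.
    by rewrite /= !inE; move: K4; move: #|K| => n; lia.
  case/negP: nP; have eK : K :=: 'N_G(P) by apply/eqP; rewrite eqEcard sK cK cN.
  have sPK : P \subset K by rewrite /= eK subsetI sPG normG.
  have nPK : P <| K by rewrite /normal sPK /= eK subsetIr.
  have sylPK := pHall_subl sPK (normal_sub nK) sylP.
  rewrite -(normal_Hall_pcore sylPK nPK).
  exact: char_normal_trans (pcore_char _ _) nK.
apply: (faithful_isog_Sym _ kerE cS) => //.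
exact: atrans_acts (Syl_trans _ _).
Qed.

(** The involutions generate the stabilizers of the points of the orbit of
    [y], so they are conjugate.  The centralizer of an involution [g]
    permutes the two fixed points of [g]; as their stabilizers have order 2,
    its order is at most 4.  So it is the only Sylow 2-subgroup containing
    [g], since these have order 4 and are abelian.  Hence there are
    [60/4 = 15] involutions.  As no element has order 4, each Sylow
    2-subgroup contains three of them, and there are [15/3 = 5] Sylow
    2-subgroups.  The kernel of the action on these has an order dividing
    12; it contains no involution, since it would contain all of them, so
    its order is at most 3. *)
Lemma isog_Alt5 y : #|G| = 60 -> #|orbit to G y| = 30 ->
    (forall x, [\/ x \in orbit to G y, #|'C_G[x | to]| = 3,
                   #|'C_G[x | to]| = 5 | #|'C_G[x | to]| = 1%N]) ->
  G \isog 'Alt_('I_5).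
Proof.
move=> cG cO types.
have cst x : x \in orbit to G y -> #|'C_G[x | to]| = 2.
  move/orbit_eqP=> e; have := card_orbit_stab to G x; rewrite e cO cG.
  by move: #|_| => n; lia.
have fixG g : g \in G^# -> exists2 x, to x g = x & g \in 'C_G[x | to].
  move=> Gg; have /card_gt0P[x /afix1P fx] : 0 < #|'Fix_to[g]| by rewrite fix2.
  exists x => //; apply/setIP; split; last exact/astab1P.
  by case/setD1P: Gg.
pose I := [set g in G | #[g] == 2].
have I1 g : g \in I -> g \in G^#.
  by rewrite inE in_setD1 => /andP[-> /eqP og]; rewrite -order_gt1 og.
have Ifix g : g \in I -> exists2 x, x \in orbit to G y & 'C_G[x | to] = <[g]>.
  move=> Ig; have [x _ gx] := fixG _ (I1 _ Ig); exists x.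
    have := order_dvdG gx; move: Ig; rewrite !inE => /andP[_ /eqP->].
    by case: (types x) => [|->|->|->].
  apply/esym/eqP; rewrite eqEcard cycle_subG gx.
  have xy : x \in orbit to G y.
    have := order_dvdG gx; move: Ig; rewrite !inE => /andP[_ /eqP->].
    by case: (types x) => [|->|->|->].
  by rewrite (cst _ xy) -orderE; move: Ig; rewrite !inE => /andP[_ /eqP->].
have IJ g h : g \in I -> h \in I -> exists2 a, a \in G & h = g ^ a.
  move=> Ig Ih; have [x xy eg] := Ifix _ Ig; have [z zy eh] := Ifix _ Ih.
  have /orbitP[a Ga xa] : z \in orbit to G x by rewrite (orbit_eqP xy).
  exists a => //; have : h \in <[g ^ a]>.
    by rewrite cycleJ -eg conjIg conjGid // -astab1_act xa eh cycle_id.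
  move: Ig Ih; rewrite !inE -(orderJ g a) => /andP[_ /eqP og] /andP[_ /eqP oh].
  by rewrite (cycle2g og) => /set2P[h1|//]; rewrite h1 order1 in oh.
have cent_le g : g \in I -> #|'C_G[g]| <= 4.
  move=> Ig; have [x xy eg] := Ifix _ Ig; have Gg := I1 _ Ig.
  rewrite -(card_orbit_stab to 'C_G[g] x) (@leq_mul _ _ 2 2) //.
    rewrite -(fix2 Gg) -afix_cycle subset_leq_card // acts_sub_orbit.
      rewrite afix_cycle; apply/afix1P/astab1P.
      by have := cycle_id g; rewrite -eg => /setIP[].
    by apply/acts_fix_norm/cents_norm; rewrite cent_cycle subsetIr.
  by rewrite -(cst _ xy) subset_leq_card //; exact: setSI (subsetIl _ _).
have [P0 sylP0] := Sylow_exists 2 G.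
have cSyl (P : {group gT}) : 2.-Sylow(G) P -> #|P| = 4.
  by move=> sylP; rewrite (card_Hall sylP) cG p_part.
have SylI (P : {group gT}) g : 2.-Sylow(G) P -> g \in P^# -> g \in I.
  move=> sylP /setD1P[g1 Pg]; have Gg := subsetP (pHall_sub sylP) _ Pg.
  have [|x _ gx] := fixG g; first by rewrite in_setD1 g1.
  have := order_dvdG gx; have := order_dvdG Pg; rewrite inE Gg (cSyl _ sylP) /=.
  have : #[g] != 1%N by rewrite order_eq1.
  have : [|| #|'C_G[x | to]| == 2, #|'C_G[x | to]| == 3,
             #|'C_G[x | to]| == 5 | #|'C_G[x | to]| == 1%N].
    by case: (types x) => [/cst->|->|->|->].
  move: #[g] #|_| => n m mP n1 n4 nm.
  have : n \in divisors 4 by rewrite -dvdn_divisors.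
  rewrite /= !inE (negbTE n1) /= => /orP[//|/eqP n4'].
  by move: mP nm; rewrite n4' => /or4P[]/eqP->.
have centE (P : {group gT}) g : 2.-Sylow(G) P -> g \in P^# -> P :=: 'C_G[g].
  move=> sylP Pg; apply/eqP.
  rewrite eqEcard (cSyl _ sylP) cent_le ?(SylI P) //.
  rewrite andbT subsetI (pHall_sub sylP) sub_cent1.
  have abP : abelian P.
    by apply: (@card_p2group_abelian _ 2); rewrite ?(cSyl _ sylP).
  by apply: (subsetP abP); case/setD1P: Pg.
have inSyl g : g \in I -> exists2 P : {group gT}, 2.-Sylow(G) P & g \in P^#.
  move=> Ig; have /setD1P[g1 Gg] := I1 _ Ig.
  have [||P sylP sgP] := @Sylow_superset 2 _ G <[g]>%G.
  - by rewrite cycle_subG.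
  - by move: Ig; rewrite inE => /andP[_ /eqP og]; rewrite /pgroup -orderE og.
  by exists P; rewrite // in_setD1 g1 -cycle_subG.
have cI : #|I| = 15.
  have /trivgPn[g P0g g1] : P0 :!=: 1 by rewrite -cardG_gt1 (cSyl _ sylP0).
  have P0g' : g \in P0^# by rewrite in_setD1 g1.
  have Ig := SylI _ _ sylP0 P0g'; have -> : I = g ^: G.
    apply/setP=> h; apply/idP/imsetP=> [Ih|[a Ga ->]].
      by have [a Ga ->] := IJ _ _ Ig Ih; exists a.
    by move: Ig; rewrite !inE orderJ => /andP[Gg ->]; rewrite groupJ.
  rewrite -index_cent1 -(centE _ _ sylP0 P0g').
  by rewrite -divgS ?(pHall_sub sylP0) // cG (cSyl _ sylP0).
have cS : #|'Syl_2(G)| = 5.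
  apply/eqP; rewrite -(eqn_pmul2r (isT : 0 < 3)) -sum_nat_const.
  rewrite -[(5 * 3)%N]cI -sum1_card.
  rewrite (partition_big (fun g => 'C_G[g]%G) (mem 'Syl_2(G))) /=; last first.
    move=> g Ig; have [P sylP Pg] := inSyl _ Ig.
    by rewrite inE /= -(centE _ _ sylP Pg).
  apply/eqP/eq_bigr => P; rewrite inE => sylP.
  rewrite sum1_card; have := cSyl P sylP; rewrite (cardsD1 1) group1 => -[<-].
  apply: eq_card => g; rewrite [RHS]inE /=.
  apply/idP/andP=> [Pg|[Ig /eqP eP]].
    split; first exact: SylI Pg.
    by apply/eqP/group_inj; rewrite /= -(centE _ _ sylP Pg).
  have /setD1P[g1 Gg] := I1 _ Ig.
  by rewrite in_setD1 g1 -eP /= inE Gg cent1id.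
have kerE : 'C_G('Syl_2(G) | 'JG) = 1.
  pose K := 'C_G('Syl_2(G) | 'JG)%G; suff: K :=: 1 by [].
  have nK : K <| G := Syl_kernel_normal 2.
  have sK : K \subset 'N_G(P0) := Syl_kernel_sub sylP0.
  have dK : #|K| %| 12.
    have <- : #|'N_G(P0)| = 12; last exact: cardSg.
    have := Lagrange (subsetIl G 'N(P0)); rewrite -(card_Syl sylP0) cS cG.
    by move: #|_| => n; lia.
  have [/(Cauchy (isT : prime 2))[g Kg og]|odK] := boolP (2 %| #|K|).
    have Ig : g \in I by rewrite inE og (subsetP (normal_sub nK)).
    have : I \subset K.
      apply/subsetP=> h Ih; have [a Ga ->] := IJ _ _ Ig Ih.
      by rewrite memJ_norm // (subsetP (normal_norm nK)).
    move/subset_leq_card; rewrite cI.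
    by move/leq_trans/(_ (dvdn_leq (isT : 0 < 12) dK)).
  apply: normal_lt4_eq1 => //.
  have : #|K| \in divisors 12 by rewrite -dvdn_divisors.
  by rewrite /= !inE; move: odK; move: #|K| => n; lia.
apply: (faithful_isog_Alt _ kerE cS) => //; last by rewrite cG.
exact: atrans_acts (Syl_trans _ _).
Qed.

End LargeOrbits.

Theorem two_fixed_points_classification :
  cyclic G \/
  [\/ G \isog 'Alt_('I_5), G \isog 'Sym_('I_4), G \isog 'Alt_('I_4)
    | exists2 k, 1 < k & G \isog [set: gsort 'D_(k.*2)]].
Proof.
have [G1|] := leqP #|G| 1.
  by left; rewrite (card_le1_trivg G1) cyclic1.
move=> G1; case: (nonfree_orbit_types G1) => [[x fx]|].
  left; have -> : G :=: 'C_G[x | to]; last exact: stabC.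
  by apply/esym/setIidPl; rewrite sub_astab1.
case=> O1 [O2 [O3 [eP sizes]]].
have PO O : O \in [set O1; O2; O3] ->
    exists2 x, O = orbit to G x & 1 < #|'C_G[x | to]|.
  rewrite -eP => /nonfree_orbitP[x eO [_ /andP[O0 OG] _]]; exists x => //.
  move: OG O0; rewrite -(card_orbit_stab to G x) eO.
  by case: #|'C_G[x | to]| => [|[|//]]; rewrite ?muln0 // muln1 ltnn.
have [x1 e1 _] : exists2 x, O1 = orbit to G x & 1 < #|'C_G[x | to]|.
  by apply: PO; rewrite !inE eqxx.
have [x2 e2 _] : exists2 x, O2 = orbit to G x & 1 < #|'C_G[x | to]|.
  by apply: PO; rewrite !inE eqxx orbT.
have [x3 e3 st3] : exists2 x, O3 = orbit to G x & 1 < #|'C_G[x | to]|.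
  by apply: PO; rewrite !inE eqxx orbT.
have types x : [\/ orbit to G x = O1, orbit to G x = O2, orbit to G x = O3
                 | #|orbit to G x| = #|G|].
  have [lt|ge] := ltnP #|orbit to G x| #|G|.
    have : orbit to G x \in nonfree_orbits by rewrite inE lt imset_f.
    rewrite eP !inE -orbA.
    by case/or3P=> /eqP->; [constructor 1 | constructor 2 | constructor 3].
  constructor 4; apply/eqP; rewrite eqn_leq ge dvdn_leq ?cardG_gt0 //.
  exact: dvdn_orbit.
right; case: sizes => [c3|[cG c1 c2 c3]|[cG c1 c2 c3]|[cG c1 c2 c3]].
- constructor 4; exists #|'C_G[x3 | to]| => //.
  rewrite e3 in c3; apply: (isog_dihedral c3 _ st3).
  by rewrite -(card_orbit_stab to G x3) c3 mul2n.
- by constructor 3; rewrite e2 in c2; apply: (isog_Alt4 _ c2).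
- constructor 2; apply: isog_Sym4 => // x.
  by case: (types x) => [->|->|->|->]; rewrite ?c1 ?c2 ?c3 ?cG.
constructor 1; apply: (isog_Alt5 _ cG (y := x1)); rewrite -?e1 // => x.
  by case: (types x) => [->|->|->|->]; rewrite ?c1 ?c2 ?c3 ?cG.
have := card_orbit_stab to G x; rewrite cG.
case: (types x) => [e|->|->|->]; last 3 first.
- by rewrite c2 => h; constructor 2; move: h; move: #|_| => n; lia.
- by rewrite c3 => h; constructor 3; move: h; move: #|_| => n; lia.
- by rewrite cG => h; constructor 4; move: h; move: #|_| => n; lia.
by move=> _; constructor 1; rewrite -e orbit_refl.
Qed.

End TwoFixedPoints.

From mathcomp Require Import boolp classical_sets functions cardinality.
From mathcomp Require Import finmap reals trigo complex.
Import Order.TTheory GRing.Theory Num.Theory.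

(** * Fixed points of linear fractional transformations *)

Section Mobius.
Local Open Scope ring_scope.
Variable R : realType.
Implicit Types (f g h : lft R) (p q z : sphere R).

Lemma lft_mulgE f g z : val (f * g)%g z = val f (val g z). Proof. by []. Qed.
Lemma lft1E z : val (1%g : lft R) z = z. Proof. by []. Qed.
Lemma lftP f g : val f =1 val g -> f = g.
Proof. by move=> e; apply/val_inj/funext. Qed.
Lemma lftK f : cancel (val f) (val f^-1%g).
Proof. by move=> z; rewrite -lft_mulgE mulVg. Qed.
Lemma lftVK f : cancel (val f^-1%g) (val f).
Proof. by move=> z; rewrite -lft_mulgE mulgV. Qed.
Lemma lft_inj f : injective (val f). Proof. exact: can_inj (lftK f). Qed.

Lemma is_lft_val f : is_lft (val f). Proof. exact: asboolW (valP f). Qed.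

Lemma fixes_conj f g z :
  val (f * g * f^-1)%g (val f z) = val f z <-> val g z = z.
Proof. by rewrite !lft_mulgE lftK; split=> [/lft_inj|->]. Qed.

Lemma to_infinity p : exists f, val f p = None.
Proof.
case: p => [z|]; last by exists 1%g.
have L : is_lft (mobius 0 1 1 (- z)).
  by exists 0, 1, 1, (- z); rewrite mul0r sub0r mulr1 oppr_eq0 oner_eq0.
by exists (mk_lft L); rewrite /= mul1r subrr eqxx.
Qed.

Lemma affine_form h : val h None = None ->
  exists a b, forall w : R[i], val h (Some w) = Some (a * w + b).
Proof.
have [a [b [c [d [D ->]]]]] := is_lft_val h; rewrite /=.
case: eqP => // c0 _; move: D.
rewrite c0 mulr0 subr0 mulf_eq0 negb_or => /andP[_ d0].
exists (a / d), (b / d) => z.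
by rewrite mul0r add0r (negbTE d0); congr Some; field.
Qed.

Lemma lft_eq1_affine h :
  (forall w : R[i], val h (Some w) = Some w) -> val h None = None -> h = 1%g.
Proof. by move=> h1 h2; apply: lftP => -[z|]. Qed.

(** Conjugation moves [p] to infinity; then [h] becomes [w |-> a * w + b], and
    two finite fixed points force [a = 1] and [b = 0]. *)
Lemma three_fixed_points h p q r : p != q -> p != r -> q != r ->
  val h p = p -> val h q = q -> val h r = r -> h = 1%g.
Proof.
have [f fp] := to_infinity p; move=> pq pr qr hp hq hr.
suff e : (f * h * f^-1 = 1)%g.
  by apply: (@mulgI _ f); apply: (@mulIg _ f^-1%g); rewrite e mulg1 mulgV.
have := fixes_conj f h; set k := (_ * _)%g => kE'.
have k0 : val k None = None by rewrite -fp; apply/kE'.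
have := (kE' q).2 hq; have := (kE' r).2 hr.
case eq : (val f q) => [u|]; last first.
  by rewrite -fp in eq; move/lft_inj: eq pq => ->; rewrite eqxx.
case er : (val f r) => [v|]; last first.
  by rewrite -fp in er; move/lft_inj: er pr => ->; rewrite eqxx.
have uv : u - v != 0.
  rewrite subr_eq0; apply: contra qr => /eqP uv; apply/eqP/(@lft_inj f).
  by rewrite eq er uv.
have [a [b kE]] := affine_form k0; rewrite !kE => -[ev] [eu].
have a1 : a = 1.
  apply: (mulIf uv); rewrite mul1r -[in RHS]eu -[in RHS]ev; ring.
have b0 : b = 0.
  by apply: (@addrI _ u); move: eu; rewrite a1 mul1r addr0.
by apply: lft_eq1_affine => // z; rewrite kE a1 b0 mul1r addr0.
Qed.

(** Either infinity is fixed, or a root [w] of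
    [c * w ^+ 2 + (d - a) * w - b] is: the denominator does not vanish
    there. *)
Lemma exists_fixed_point h : exists p, val h p = p.
Proof.
have [a [b [c [d [D ->]]]]] := is_lft_val h.
have [c0|c0] := eqVneq c 0; first by exists None; rewrite /= c0 eqxx.
pose s := sqrtC ((a - d) ^+ 2 + 4%:R * b * c).
pose z := ((a - d) + s) / (2%:R * c).
have zE : c * z ^+ 2 + (d - a) * z - b = 0.
  have -> : c * z ^+ 2 + (d - a) * z - b =
      (s ^+ 2 - ((a - d) ^+ 2 + 4%:R * b * c)) / (4%:R * c).
    by rewrite /z; field.
  by rewrite sqrtCK subrr mul0r.
exists (Some z) => /=; case: eqP => [e|/eqP ne].
  (* Otherwise the numerator would vanish too, and so would the determinant. *)
  have az : a * z + b = 0.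
    have : z * (c * z + d) - (a * z + b) = 0 by rewrite -[RHS]zE; ring.
    by rewrite e mulr0 sub0r => /eqP; rewrite oppr_eq0 => /eqP.
  case/eqP: D; apply: (mulfI c0); rewrite mulr0.
  have -> : c * (a * d - b * c) =
      c * a * (c * z + d) - c * c * (a * z + b) by ring.
  by rewrite e az !mulr0 subrr.
congr Some; apply: (canLR (mulfK ne)); apply/eqP.
by rewrite eq_sym -subr_eq0 -[X in _ == X]zE; apply/eqP; ring.
Qed.

Lemma translation_expg h (b : R[i]) :
  (forall w : R[i], val h (Some w) = Some (w + b)) ->
  forall n (w : R[i]), val (h ^+ n)%g (Some w) = Some (w + b *+ n).
Proof.
move=> hE; elim=> [|n IH] z; first by rewrite expg0 lft1E mulr0n addr0.
by rewrite expgSr lft_mulgE hE IH mulrS addrA.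
Qed.

(** If [a <> 1], then [w |-> a * w + b] fixes [b / (1 - a)]; otherwise it is a
    translation, and [b *+ n = 0] makes it the identity. *)
Lemma second_fixed_point h n : (0 < n)%N -> (h ^+ n)%g = 1%g -> h != 1%g ->
  val h None = None -> exists w : R[i], val h (Some w) = Some w.
Proof.
move=> n0 hn h1 h0; have [a [b hE]] := affine_form h0.
have [a1|a1] := eqVneq a 1; last first.
  exists (b / (1 - a)); rewrite hE; congr Some; field.
  by rewrite subr_eq0 eq_sym.
have tr w : val h (Some w) = Some (w + b) by rewrite hE a1 mul1r.
have := translation_expg tr n 0; rewrite hn lft1E add0r => -[/esym/eqP].
rewrite mulrn_eq0 eqn0Ngt n0 /= => /eqP b0; case/eqP: h1.
by apply: lft_eq1_affine => // w; rewrite tr b0 addr0.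
Qed.

Lemma two_fixed_points h n : (0 < n)%N -> (h ^+ n)%g = 1%g -> h != 1%g ->
  exists p q, p != q /\ (forall z, val h z = z <-> z = p \/ z = q).
Proof.
move=> n0 hn h1; have [p hp] := exists_fixed_point h.
have [f fp] := to_infinity p; set k := (f * h * f^-1)%g.
have kJ : k = (h ^ f^-1)%g by rewrite conjgE invgK mulgA.
have kn : (k ^+ n = 1)%g by rewrite kJ -conjXg hn conj1g.
have k1 : k != 1%g.
  apply: contra h1 => /eqP; rewrite kJ => e.
  by rewrite -[h](conjgK f^-1%g) e conj1g.
have k0 : val k None = None by rewrite -fp; apply/fixes_conj.
have [w kw] := second_fixed_point n0 kn k1 k0.
have pq : p != val f^-1%g (Some w).
  by apply/eqP => e; move: fp; rewrite e lftVK.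
have hq : val h (val f^-1%g (Some w)) = val f^-1%g (Some w).
  by apply/(fixes_conj f); rewrite lftVK.
exists p, (val f^-1%g (Some w)); split=> // z; split=> [hz|[]->] //.
have [->|zp] := eqVneq z p; first by left.
have [->|zq] := eqVneq z (val f^-1%g (Some w)); first by right.
by case/eqP: h1; apply: (three_fixed_points pq) hp hq hz; rewrite eq_sym.
Qed.

(** The coefficient [a] of [w |-> a * w + b]; the formula is meant only for
    transformations that fix infinity. *)
Definition multiplier h : R[i] :=
  odflt 0 (val h (Some 1)) - odflt 0 (val h (Some 0)).

Lemma multiplierE h a b :
  (forall w : R[i], val h (Some w) = Some (a * w + b)) -> multiplier h = a.
Proof. by move=> hE; rewrite /multiplier !hE /=; ring. Qed.

Lemma multiplierM g h : val g None = None -> val h None = None ->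
  multiplier (g * h)%g = multiplier g * multiplier h.
Proof.
move=> /affine_form[a [b gE]] /affine_form[c [d hE]].
rewrite (multiplierE gE) (multiplierE hE).
apply: (@multiplierE _ _ (a * d + b)) => w.
by rewrite lft_mulgE hE gE; congr Some; ring.
Qed.

Lemma multiplier_eq1 h n : (0 < n)%N -> (h ^+ n)%g = 1%g -> val h None = None ->
  multiplier h = 1 <-> h = 1%g.
Proof.
move=> n0 hn h0; split=> [m1|->]; last by rewrite /multiplier /= subr0.
apply/eqP/negP=> /negP h1; have [w hw] := second_fixed_point n0 hn h1 h0.
have [a [b hE]] := affine_form h0; rewrite (multiplierE hE) in m1.
case/eqP: h1; apply: lft_eq1_affine => // u; move: hw; rewrite !hE m1 !mul1r.
case=> wb; have -> : b = 0 by apply: (@addrI _ w); rewrite wb addr0.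
by rewrite addr0.
Qed.

End Mobius.

(** * Finite groups of linear fractional transformations *)

(** The group of all linear fractional transformations is infinite; the
    elements of a [fin_lft_group] form a type that can carry a
    [finGroupType] structure. *)
Record fin_lft_group (R : realType) := FinLftGroup {
  lft_fset : {fset lft R};
  fin_lft1 : 1%g \in lft_fset;
  fin_lftM : {in lft_fset &, forall g h, (g * h)%g \in lft_fset};
  fin_lftV : {in lft_fset, forall g, g^-1%g \in lft_fset}
}.

Definition lft_elt (R : realType) (A : fin_lft_group R) : Type := lft_fset A.
HB.instance Definition _ R (A : fin_lft_group R) :=
  Finite.copy (lft_elt A) (lft_fset A).
HB.instance Definition _ R (A : fin_lft_group R) :=
  SubType.copy (lft_elt A) (lft_fset A).

Section FinLftGroup.
Local Open Scope classical_set_scope.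
Variables (R : realType) (A : fin_lft_group R).
Local Notation eltA := (lft_elt A).
Local Notation fullA := [set: lft_elt A]%SET.

Definition elt_mul (g h : eltA) : eltA := [` fin_lftM (valP g) (valP h)]%fset.
Definition elt_one : eltA := [` fin_lft1 A]%fset.
Definition elt_inv (g : eltA) : eltA := [` fin_lftV (valP g)]%fset.

Lemma elt_mulA : associative elt_mul.
Proof. by move=> f g h; apply: val_inj; rewrite /= mulgA. Qed.
Lemma elt_mul1 : left_id elt_one elt_mul.
Proof. by move=> f; apply: val_inj; rewrite /= mul1g. Qed.
Lemma elt_mulV : left_inverse elt_one elt_inv elt_mul.
Proof. by move=> f; apply: val_inj; rewrite /= mulVg. Qed.
HB.instance Definition _ :=
  Finite_isGroup.Build eltA elt_mulA elt_mul1 elt_mulV.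

Lemma val_eltM (g h : eltA) : val (g * h)%g = (val g * val h)%g.
Proof. by []. Qed.
Lemma val_eltX (g : eltA) n : val (g ^+ n)%g = (val g ^+ n)%g.
Proof. by elim: n => [|n IH]; rewrite ?expg0 // !expgS val_eltM IH. Qed.

Lemma elt_exp (g : eltA) : (val g ^+ #[g] = 1)%g.
Proof. by rewrite -val_eltX expg_order. Qed.

Lemma elt_fixed (g : eltA) : g != 1%g ->
  exists p q, p != q /\ (forall z, val (val g) z = z <-> z = p \/ z = q).
Proof.
move=> g1; apply: (two_fixed_points (n := #[g]%g)); first exact: order_gt0.
  exact: elt_exp.
by apply: contra g1 => /eqP g1; apply/eqP/val_inj.
Qed.

Definition poles : set (sphere R) :=
  \bigcup_(g in [set g : eltA | g != 1%g]) [set z | val (val g) z = z].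

Lemma finite_poles : finite_set poles.
Proof.
apply: bigcup_finite; first exact: finite_finset.
move=> g /= /elt_fixed[p [q [_ H]]].
by apply: sub_finite_set (finite_set2 p q) => z /= /H.
Qed.

Definition pole : Type := fset_set poles.
HB.instance Definition _ := Finite.copy pole (fset_set poles).
HB.instance Definition _ := SubType.copy pole (fset_set poles).

Lemma poleP z :
  z \in fset_set poles <-> exists2 g : eltA, g != 1%g & val (val g) z = z.
Proof.
rewrite in_fset_set; last exact: finite_poles.
by split=> [/set_mem[g g1 gz]|[g g1 gz]]; [exists g|apply/mem_set; exists g].
Qed.

Lemma pole_moved (z : pole) (g : eltA) :
  val (val g^-1%g) (val z) \in fset_set poles.
Proof.
have /poleP[h h1 hz] := valP z; apply/poleP; exists (h ^ g)%g.
  by apply: contra h1 => /eqP e; rewrite -[h](conjgK g) e conj1g.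
by rewrite conjgE !val_eltM !lft_mulgE lftVK hz.
Qed.

(** Inverting [g] turns the left action on the sphere into a right action. *)
Definition pole_act (z : pole) (g : eltA) : pole := [` pole_moved z g]%fset.

Lemma pole_act1 : pole_act^~ 1%g =1 id.
Proof. by move=> z; apply: val_inj; rewrite /= invg1. Qed.
Lemma pole_actM z : act_morph pole_act z.
Proof. by move=> g h; apply: val_inj; rewrite /= invMg. Qed.

Definition pole_action := TotalAction pole_act1 pole_actM.

Lemma pole_fix2 :
  {in fullA^#%g, forall g, #|'Fix_pole_action[g]%g| = 2%N}.
Proof.
move=> g; rewrite in_setD1 => /andP[g1 _]; have [p [q [pq H]]] := elt_fixed g1.
have pP : p \in fset_set poles by apply/poleP; exists g => //; apply/H; left.
have qP : q \in fset_set poles by apply/poleP; exists g => //; apply/H; right.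
pose P : pole := [` pP]%fset; pose Q : pole := [` qP]%fset.
have -> : 'Fix_pole_action[g]%g = [set P; Q]%SET.
  apply/setP=> z; apply/afix1P/set2P=> [/(congr1 val) gz|zPQ].
    have {}gz : val (val g)^-1%g (val z) = val z := gz.
    case: (H (val z)).1 => [|e|e]; first by rewrite -{1}gz lftVK.
      by left; apply: val_inj.
    by right; apply: val_inj.
  apply: val_inj; rewrite /= -[in RHS](lftK (val g) (val z)); congr (val _ _).
  by apply/esym/H; case: zPQ => ->; [left|right].
rewrite cards2; suff -> : P != Q by [].
by rewrite -val_eqE.
Qed.

(** Moving [x] to infinity, the multiplier becomes an injective morphism to the
    field: a transformation of finite order with multiplier 1 is trivial. *)
Lemma pole_stab_cyclic x : cyclic 'C_fullA[x | pole_action]%g.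
Proof.
have [f fx] := to_infinity (val x).
pose k (g : eltA) := (f * val g * f^-1)%g.
have k0 g : g \in 'C_fullA[x | pole_action]%g -> val (k g) None = None.
  case/setIP=> _ /astab1P/(congr1 val) gx; rewrite -fx; apply/fixes_conj.
  have {}gx : val (val g)^-1%g (val x) = val x := gx.
  by rewrite -{1}gx lftVK.
apply: (field_mul_group_cyclic (f := fun g => multiplier (k g)))
  => [g h Gg Gh|g Gg].
  rewrite -multiplierM ?k0 //; congr multiplier.
  by rewrite /k val_eltM !mulgA mulgKV.
rewrite (multiplier_eq1 (order_gt0 g)) ?k0 //; last first.
  have -> : k g = (val g ^ f^-1)%g by rewrite conjgE invgK mulgA.
  by rewrite -conjXg elt_exp conj1g.
split=> [e|->]; last by rewrite /k mulg1 mulgV.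
by apply/val_inj/(@mulgI _ f)/(@mulIg _ f^-1%g); rewrite [LHS]e mulg1 mulgV.
Qed.

Theorem fin_lft_classification :
  cyclic fullA \/
  [\/ fullA \isog 'Alt_('I_5), fullA \isog 'Sym_('I_4), fullA \isog 'Alt_('I_4)
    | exists2 k : nat, (1 < k)%N & fullA \isog dihedral k]%g.
Proof.
exact: (two_fixed_points_classification pole_fix2 pole_stab_cyclic).
Qed.

Lemma isog_iso_to (hT : finGroupType) (H : {group hT}) :
  (fullA \isog H)%g -> iso_to [set` lft_fset A] H.
Proof.
rewrite isog_sym => /isogP[f injf fH]; exists (fun x => val (f x)).
  by move=> x y Hx Hy; rewrite morphM // val_eltM.
split=> [x Hx|x y /set_mem Hx /set_mem Hy|g Ag].
- exact: valP.
- by move/val_inj/(injmP injf); apply.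
have : ([` Ag]%fset : eltA) \in (f @* H)%g by rewrite fH inE.
by case/morphimP=> x Hx _ e; exists x => //=; rewrite -e.
Qed.

End FinLftGroup.

(** * Rotations *)

Section Rotations.
Local Open Scope classical_set_scope.
Local Open Scope ring_scope.
Variable R : realType.
Implicit Types (n m : nat) (w : R[i]) (h : lft R) (alpha : set (sphere R)).

Definition root_of_unity m : R[i] := expi (2 * pi / m%:R).

Lemma expiD (s t : R) : expi (s + t) = expi s * expi t.
Proof.
rewrite /expi cosD sinD; apply/eqP; rewrite eq_complex /= eqxx /=.
by rewrite addrC eqxx.
Qed.

Lemma expi0 : expi (0 : R) = 1.
Proof. by rewrite /expi cos0 sin0. Qed.

Lemma expiX (t : R) n : expi t ^+ n = expi (t * n%:R).
Proof.
elim: n => [|n IH]; first by rewrite mulr0 expi0.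
by rewrite exprS IH -expiD mulrS mulrDr mulr1.
Qed.

Lemma expi2pi : expi (2 * pi : R) = 1.
Proof. by rewrite mulr_natl /expi cos2pi sin2pi. Qed.

(** Indeed [cos t = 1 - 2 * sin (t / 2) ^+ 2], and [0 < t / 2 < pi]. *)
Lemma expi_neq1 (t : R) : 0 < t < 2 * pi -> expi t != 1.
Proof.
move=> tb; apply/eqP=> -[c1 _].
have : 0 < sin (t / 2) by apply: sin_gt0_pi; lra.
have : cos t = 1 - sin (t / 2) ^+ 2 *+ 2.
  have {1}-> : t = (t / 2) *+ 2 by rewrite -mulr_natr divfK ?pnatr_eq0.
  rewrite cos_mulr2n cos2sin2; ring.
by rewrite c1; nra.
Qed.

Lemma root_of_unity_prim m : (0 < m)%N -> m.-primitive_root (root_of_unity m).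
Proof.
move=> m0; have mR : (m%:R : R) != 0 by rewrite pnatr_eq0 -lt0n.
have [|d prim dm] := prim_order_exists m0 (z := root_of_unity m).
  by rewrite expiX divfK // expi2pi.
have [dE|dlt] : d = m \/ (d < m)%N.
  by have := dvdn_leq m0 dm; rewrite leq_eqVlt => /orP[/eqP|]; [left|right].
  by rewrite dE in prim.
have := prim_expr_order prim; rewrite expiX => /eqP.
rewrite (negbTE (expi_neq1 _)) //.
have d0 : (0 < d)%N := prim_order_gt0 prim.
have mp : 0 < m%:R :> R by rewrite ltr0n.
have -> : 2 * pi / m%:R * d%:R = (2 * pi) * (d%:R / m%:R) :> R by field.
have p0 := pi_gt0 R.
rewrite mulr_gt0 ?divr_gt0 ?ltr0n //=; last lra.
by rewrite gtr_pMr ?ltr_pdivrMr ?mul1r ?ltr_nat //; lra.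
Qed.

Lemma rotationE m (z : sphere R) :
  val (rotation R m) z = omap ( *%R (root_of_unity m)) z.
Proof. by []. Qed.

Lemma rotationX m k (z : sphere R) :
  val (rotation R m ^+ k)%g z = omap ( *%R (root_of_unity m ^+ k)) z.
Proof.
elim: k z => [|k IH] z.
  by rewrite expg0 lft1E; case: z => //= z; rewrite mul1r.
rewrite expgSr lft_mulgE IH rotationE.
by case: z => //= z; rewrite mulrA -exprSr.
Qed.

Lemma rotationX_order m : (0 < m)%N -> (rotation R m ^+ m)%g = 1%g.
Proof.
move=> m0; apply: lftP => z.
rewrite rotationX (prim_expr_order (root_of_unity_prim m0)).
by case: z => //= z; rewrite mul1r.
Qed.

Lemma rotationX_eq1 m k :
  (0 < m)%N -> (rotation R m ^+ k)%g = 1%g -> (m %| k)%N.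
Proof.
move=> m0 /(congr1 (fun f : lft R => val f (Some 1))).
rewrite rotationX lft1E /= mulr1.
by case=> /eqP; rewrite -(prim_order_dvd (root_of_unity_prim m0)).
Qed.

Lemma mem_generated_rotation n h : (0 < n)%N ->
  generated_subgroup [set rotation R n] h <->
  exists k, h = (rotation R n ^+ k)%g.
Proof.
move=> n0; split.
  pose X := [set f | exists k, f = (rotation R n ^+ k)%g].
  apply: (@smallest_sub _ _ _ X) => [/=|_ ->]; last first.
    by exists 1%N; rewrite expg1.
  split; first by apply/mem_set; exists 0%N.
  (* The inverse of the rotation is its power of exponent [n.-1]. *)
  move=> f g /set_mem[i ->] /set_mem[j ->]; apply/mem_set.
  exists (i + j * n.-1)%N.
  rewrite expgD expgM; congr (_ * _)%g.
  apply: (@mulgI _ (rotation R n ^+ j)%g); rewrite mulgV -expgS prednK //.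
  by rewrite -!expgM mulnC expgM rotationX_order // expg1n.
case=> k -> M [[/set_mem M1 Mdiv] /(_ _ erefl) Mr].
have MM f g : M f -> M g -> M (f * g)%g.
  have gM := group_closedM (conj (mem_set M1) Mdiv).
  by move=> /mem_set Mf /mem_set Mg; apply/set_mem/gM.
elim: k => [|k IH]; first by rewrite expg0.
by rewrite expgSr; apply: MM.
Qed.

End Rotations.

(** * Stabilizers of sets of points *)

Section Stab.
Local Open Scope classical_set_scope.
Local Open Scope ring_scope.
Variables (R : realType) (alpha : set (sphere R)).

Lemma stabP h : stab alpha h -> forall z, alpha (val h z) <-> alpha z.
Proof.
move=> ha z; rewrite -{1}ha; split=> [[y ay /lft_inj<-]//|az].
by exists z.
Qed.

Lemma stab1 : stab alpha 1%g.
Proof.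
by apply/seteqP; split=> [_ [z az <-]|z az]; [rewrite lft1E | exists z].
Qed.

Lemma stabM g h : stab alpha g -> stab alpha h -> stab alpha (g * h)%g.
Proof.
move=> sg sh; apply/seteqP; split=> [_ [z az <-]|z].
  by apply/(stabP sg)/(stabP sh).
by rewrite -{1}sg => -[y]; rewrite -{1}sh => -[x ax <-] <-; exists x.
Qed.

Lemma stabV g : stab alpha g -> stab alpha g^-1%g.
Proof.
move=> sg; apply/seteqP; split=> [_ [z az <-]|z az].
  by apply/(stabP sg); rewrite lftVK.
by exists (val g z); rewrite ?lftK //; apply/(stabP sg).
Qed.

(** A transformation that stabilizes [alpha] is determined by the images in
    [alpha] of three points of [alpha]. *)
Lemma finite_stab : finite_set alpha -> (2 < #|` fset_set alpha|)%N ->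
  finite_set (stab alpha).
Proof.
move=> fa; have memE z : z \in enum_fset (fset_set alpha) -> alpha z.
  by move=> az; apply/set_mem; rewrite -in_fset_set.
have := fset_uniq (fset_set alpha); move: memE.
case: (enum_fset _) => [|p [|q [|r s]]] //= memE.
rewrite !inE !negb_or => /andP[/and3P[pq pr _] /andP[/andP[qr _] _]] _.
have [ap aq ar] : [/\ alpha p, alpha q & alpha r].
  by split; apply: memE; rewrite !inE eqxx ?orbT.
pose F (h : lft R) := (val h p, val h q, val h r).
apply: (@sub_finite_set _ _ (F @^-1` (alpha `*` alpha `*` alpha))).
  by move=> h sh /=; split; [split|]; apply/(stabP sh).
apply: finite_preimage; last by do ?apply: finite_setX.
move=> g h _ _ [gp gq gr]; apply: (@mulgI _ g^-1%g); rewrite mulVg; apply/esym.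
apply: (three_fixed_points pq pr qr); rewrite lft_mulgE.
- by rewrite -(gp : val g p = val h p) lftK.
- by rewrite -(gq : val g q = val h q) lftK.
- by rewrite -(gr : val g r = val h r) lftK.
Qed.

Lemma stab_fin_lft_group : finite_set alpha -> (2 < #|` fset_set alpha|)%N ->
  exists A : fin_lft_group R, [set` lft_fset A] = stab alpha.
Proof.
move=> fa ca; have fs := finite_stab fa ca.
set S := fset_set (stab alpha); have memE h : h \in S <-> stab alpha h.
  by rewrite in_fset_set //; split=> [/set_mem|/mem_set].
have h1 : 1%g \in S by apply/memE/stab1.
have hM : {in S &, forall g h, (g * h)%g \in S}.
  by move=> g h /memE sg /memE sh; apply/memE/stabM.
have hV : {in S, forall g, (g^-1)%g \in S}.
  by move=> g /memE sg; apply/memE/stabV.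
by exists (FinLftGroup h1 hM hV); rewrite fset_setK.
Qed.

Lemma rot_block_rotation m B : @rot_blocks R m B -> val (rotation R m) @` B = B.
Proof.
case=> [[->|->]|[z _ <-]]; rewrite ?image_set1 //=; first by rewrite mulr0.
have step (k : int) : expi ((k + 1)%:~R / m%:R * (2 * pi)) * z =
    root_of_unity R m * (expi (k%:~R / m%:R * (2 * pi)) * z).
  rewrite mulrA -expiD; congr (expi _ * _).
  by rewrite intrD mulr1z; ring.
apply/seteqP; split=> [_ [_ [k _ <-] <-]|_ [k _ <-]] /=.
  by exists (k + 1) => //; rewrite step.
exists (Some (expi ((k - 1)%:~R / m%:R * (2 * pi)) * z)).
  by exists (k - 1).
by congr Some; rewrite -[LHS]/(root_of_unity R m * _) -step subrK.
Qed.

Lemma rot_orbit_sub m z : stab alpha (rotation R m) -> alpha (Some z) ->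
  rot_orbit m z `<=` alpha.
Proof.
move=> sr az _ [k _ <-].
have step (i : int) :
    alpha (Some (expi ((i + 1)%:~R / m%:R * (2 * pi)) * z)) <->
    alpha (Some (expi (i%:~R / m%:R * (2 * pi)) * z)).
  have := stabP sr (Some (expi (i%:~R / m%:R * (2 * pi)) * z)).
  rewrite rotationE /= mulrA -expiD; set t := (_ + _ : R).
  have -> // : t = (i + 1)%:~R / m%:R * (2 * pi).
  by rewrite /t intrD mulr1z; ring.
elim: k => [|k IH|k IH].
- by rewrite mul0r mul0r expi0 mul1r.
- by rewrite -addn1 PoszD; apply/step.
- by apply/step; rewrite -addn1 PoszD opprD subrK.
Qed.

(** The rotation permutes every block; conversely, a set stable under it
    contains the block of each of its points. *)
Lemma union_of_rot_blocks m :
  is_union_of (rot_blocks m) alpha <-> stab alpha (rotation R m).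
Proof.
split=> [[S sS aE]|sr].
  rewrite /stab /= aE image_bigcup; apply: eq_bigcupr => B /sS.
  exact: rot_block_rotation.
exists [set B | @rot_blocks R m B /\ B `<=` alpha]; first by move=> B [].
apply/seteqP; split=> [z az|z [B [_]]]; last exact.
case: z az => [z|] az; last first.
  by exists [set None] => //; split=> [|_ ->] //; left; left.
have [z0|z0] := eqVneq z 0.
  by exists [set Some 0]; rewrite z0 in az *; split=> [|_ ->] //; left; right.
exists (rot_orbit m z); first by split; [right; exists z|exact: rot_orbit_sub].
by exists 0 => //; rewrite mul0r mul0r expi0 mul1r.
Qed.

End Stab.

(** * Cyclic groups containing a rotation *)

Section Cyclic.
Local Open Scope classical_set_scope.
Local Open Scope ring_scope.
Variables (R : realType) (A : fin_lft_group R) (n : nat).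
Hypotheses (n2 : (2 <= n)%N) (rA : rotation R n \in lft_fset A).
Local Notation eltA := (lft_elt A).
Local Notation fullA := [set: lft_elt A]%SET.
Hypothesis cycA : cyclic fullA.

Lemma rotation_fixed z : val (rotation R n) z = z -> z = None \/ z = Some 0.
Proof.
case: z => [z|]; [|by left]; case=> e; right; congr Some; apply/eqP.
have [//|z0] := eqVneq z 0.
have : root_of_unity R n = 1 by apply: (mulIf z0); rewrite mul1r.
have prim := root_of_unity_prim R (ltnW n2).
move/eqP; rewrite -[X in X == _]expr1 -(prim_order_dvd prim) dvdn1.
by move/eqP=> e1; move: n2; rewrite e1.
Qed.

(** The two fixed points of a generator are fixed by the rotation, which is one
    of its powers; so they are infinity and 0, and every element fixes them. *)
Lemma cyclic_fixes_0_infinity (h : eltA) :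
  val (val h) None = None /\ val (val h) (Some 0) = Some 0.
Proof.
pose rho : eltA := [` rA]%fset; have /cyclicP[g eg] := cycA.
have inX (x : eltA) : exists i, x = (g ^+ i)%g.
  by apply/cycleP; rewrite -eg inE.
have fixX z i : val (val g) z = z -> val (val (g ^+ i)%g) z = z.
  move=> gz; elim: i => [|i IH]; first by rewrite expg0.
  by rewrite expgS val_eltM lft_mulgE IH.
have [i ei] := inX rho.
have g1 : g != 1%g.
  apply/eqP=> g1; have : val rho = 1%g by rewrite ei g1 expg1n.
  rewrite -[val rho]/(rotation R n) -[rotation R n]expg1.
  move/(rotationX_eq1 (ltnW n2)).
  by rewrite dvdn1 => /eqP e1; move: n2; rewrite e1.
have [p [q [pq H]]] := elt_fixed g1.
have rfix z : val (val g) z = z -> z = None \/ z = Some 0.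
  move=> gz; apply: rotation_fixed.
  by rewrite -[rotation R n]/(val rho) ei fixX.
have gp : val (val g) p = p by apply/H; left.
have gq : val (val g) q = q by apply/H; right.
suff [g0 goo] : val (val g) (Some 0) = Some 0 /\ val (val g) None = None.
  by have [j ->] := inX h; split; apply: fixX.
have rp := rfix _ gp; have rq := rfix _ gq.
by move: gp gq pq; case: rp => ->; case: rq => ->; rewrite ?eqxx.
Qed.

Lemma cyclic_scaling (h : eltA) (w : R[i]) :
  val (val h) (Some w) = Some (multiplier (val h) * w).
Proof.
have [h0 hz] := cyclic_fixes_0_infinity h; have [a [b hE]] := affine_form h0.
rewrite (multiplierE hE) hE; congr Some; move: hz; rewrite hE mulr0 add0r.
by case=> ->; rewrite addr0.
Qed.

Lemma multiplierX (h : eltA) k :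
  multiplier (val (h ^+ k)%g) = multiplier (val h) ^+ k.
Proof.
elim: k => [|k IH]; first by rewrite /multiplier /= subr0.
rewrite expgS val_eltM multiplierM ?exprS ?IH //.
  exact: (cyclic_fixes_0_infinity h).1.
exact: (cyclic_fixes_0_infinity (h ^+ k)%g).1.
Qed.

Lemma multiplier_inj (g h : eltA) :
  multiplier (val g) = multiplier (val h) -> g = h.
Proof.
move=> e; apply/val_inj/lftP => -[z|]; first by rewrite !cyclic_scaling e.
by rewrite !(cyclic_fixes_0_infinity _).1.
Qed.

Lemma elt_expg_card (h : eltA) : (h ^+ #|fullA| = 1)%g.
Proof. by apply: (@expg_cardG _ [set: eltA]%G); rewrite inE. Qed.

Lemma multiplier_root (h : eltA) : multiplier (val h) ^+ #|fullA| = 1.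
Proof. by rewrite -multiplierX elt_expg_card /multiplier /= subr0. Qed.

(** With [m] the order of the group, the multipliers are [m] distinct [m]-th
    roots of unity, hence all of them. *)
Lemma cyclic_rotation_mem : rotation R #|fullA| \in lft_fset A.
Proof.
set m := #|fullA|; have m0 : (0 < m)%N := cardG_gt0 _.
pose rs := [seq multiplier (val h) | h <- enum fullA].
have : root_of_unity R m \in rs.
  rewrite -(@mem_unity_roots _ m rs) //.
  - rewrite -topredE /= unity_rootE.
    by rewrite (prim_expr_order (root_of_unity_prim R m0)).
  - by apply/allP=> _ /mapP[h _ ->]; rewrite unity_rootE multiplier_root.
  - by rewrite map_inj_uniq ?enum_uniq //; exact: multiplier_inj.
  - by rewrite size_map -cardE.
case/mapP=> h _ e; have -> : rotation R m = val h; last exact: valP.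
apply: lftP => -[z|]; first by rewrite cyclic_scaling -e.
by rewrite (cyclic_fixes_0_infinity _).1.
Qed.

Lemma cyclic_rotationX (h : eltA) :
  exists k, val h = (rotation R #|fullA| ^+ k)%g.
Proof.
have prim := root_of_unity_prim R (cardG_gt0 fullA).
have [i e] := prim_rootP prim (multiplier_root h); exists i.
apply: lftP => -[z|]; first by rewrite cyclic_scaling rotationX e.
by rewrite (cyclic_fixes_0_infinity _).1 rotationX.
Qed.

Lemma cyclic_rotation_dvd : (n %| #|fullA|)%N.
Proof.
apply: (@rotationX_eq1 R); first exact: ltnW.
pose rho : eltA := [` rA]%fset; rewrite -[rotation R n]/(val rho) -val_eltX.
by rewrite elt_expg_card.
Qed.

End Cyclic.

(** * Involutions *)

Section Involutions.
Local Open Scope classical_set_scope.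
Local Open Scope ring_scope.

(** Such a transformation is a multiplication by [a] with [a ^+ 2 = 1] and
    [a <> 1].  Hence the group generated by a rotation has at most one
    involution. *)
Lemma generated_involution (R : realType) n (h : lft R) : (0 < n)%N ->
  generated_subgroup [set rotation R n] h -> h != 1%g -> (h * h = 1)%g ->
  forall z, val h z = omap -%R z.
Proof.
move=> n0 /(mem_generated_rotation _ n0)[k ->].
set a := root_of_unity R n ^+ k => h1.
move/(congr1 (fun f : lft R => val f (Some 1))).
rewrite lft_mulgE !rotationX -/a lft1E /= mulr1.
case=> /eqP; rewrite -expr2 sqrf_eq1 => /orP[/eqP a1|/eqP aN] z; last first.
  by rewrite rotationX -/a aN; case: z => //= z; rewrite mulN1r.
case/eqP: h1; apply: lftP => y; rewrite rotationX -/a a1.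
by case: y => //= y; rewrite mul1r.
Qed.

Lemma iso_to_generated_involutions (R : realType) n (hT : finGroupType)
    (H : {group hT}) x y :
  (0 < n)%N -> iso_to (generated_subgroup [set rotation R n]) H ->
  x \in H -> y \in H -> x != 1%g -> y != 1%g ->
  (x * x = 1)%g -> (y * y = 1)%g -> x = y.
Proof.
move=> n0 [f fM [fH finj _]] Hx Hy x1 y1 xx yy.
have H1 : 1%g \in H := group1 H.
have f1 : f 1%g = 1%g by apply: (@mulgI _ (f 1%g)); rewrite -fM // !mulg1.
have fE u : u \in H -> u != 1%g -> (u * u = 1)%g ->
    forall z, val (f u) z = omap -%R z.
  move=> Hu u1 uu; apply: (generated_involution n0 (fH _ Hu)).
    apply: contra u1 => /eqP fu; apply/eqP.
    by apply: finj; rewrite ?f1 //; exact/mem_set.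
  by rewrite -fM ?uu.
apply: finj; try exact/mem_set.
by apply: lftP => z; rewrite !fE.
Qed.

(** These are the double transpositions [(0 1)(2 3)] and [(0 2)(1 3)]. *)
Lemma two_even_involutions m : (4 <= m)%N -> exists x y : {perm 'I_m},
  [/\ x \in ('Alt_('I_m))%g, y \in ('Alt_('I_m))%g, x != 1%g /\ y != 1%g,
      (x * x = 1)%g /\ (y * y = 1)%g & x != y].
Proof.
move=> m4.
have [a [b [c [d uq]]]] : exists a b c d : 'I_m, uniq [:: a; b; c; d].
  pose o i (lt : (i < 4)%N) := Ordinal (leq_trans lt m4).
  by exists (@o 0%N isT), (@o 1%N isT), (@o 2%N isT), (@o 3%N isT).
have key (i j k l : 'I_m) :
   uniq [:: i; j; k; l] -> let x := (tperm i j * tperm k l)%g in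
   [/\ x \in ('Alt_('I_m))%g, x != 1%g, (x * x = 1)%g & x i = j].
  move=> uq' x; rewrite /x {x}; rewrite /= !inE !negb_or in uq'.
  case/and4P: uq' => /and3P[ij ik il] /andP[jk jl] kl _.
  have xi : (tperm i j * tperm k l)%g i = j.
    by rewrite permM tpermL tpermD // eq_sym.
  split=> //.
  - by rewrite Alt_even odd_mul_tperm ij odd_tperm kl.
  - by apply: contraNneq ij => x1; rewrite -[j]xi x1 perm1.
  have com : commute (tperm i j) (tperm k l).
    by rewrite /commute [LHS]conjgC tpermJ !tpermD // eq_sym.
  by have := expgMn 2 com; rewrite !expgS !expg0 !mulg1 !tperm2 mulg1.
have [x1 x2 x3 xa] := key _ _ _ _ uq.
have uq' : uniq [:: a; c; b; d].
  rewrite -(perm_uniq (s1 := [:: a; b; c; d])) // perm_cons.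
  by rewrite (perm_catCA [:: b] [:: c] [:: d]).
have [y1 y2 y3 ya] := key _ _ _ _ uq'.
do 2 eexists; split; [exact: x1|exact: y1|by split|by split|].
apply: contraTneq uq => /(congr1 (fun s : {perm 'I_m} => s a)).
rewrite xa ya => ->.
by rewrite /= !inE eqxx /= andbF.
Qed.

(** The group is generated by two elements whose squares are trivial; were one
    of them trivial, or both equal, it would be cyclic of order at most 2. *)
Lemma two_dihedral_involutions k : (2 <= k)%N ->
  exists x y : extremal.dihedral_gtype k.*2,
  [/\ x != 1%g, y != 1%g, (x * x = 1)%g, (y * y = 1)%g & x != y].
Proof.
move=> k2; have := isoGrp_hom (Grp'_dihedral k2).
case/existsP=> -[x y] /= /eqP[defG x2 y2 _]; exists x, y.
have small z :
    (z ^+ 2 = 1)%g -> <[z]>%g != [set: extremal.dihedral_gtype k.*2]%SET.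
  move=> z2; apply/eqP=> e; have : (#[z]%g <= 2)%N.
    by apply: dvdn_leq => //; rewrite order_dvdn z2.
  by rewrite orderE e card_dihedral //; lia.
split=> //.
- by apply: contra (small y y2) => /eqP x1; rewrite -defG x1 cycle1 joing1G.
- by apply: contra (small x x2) => /eqP y1; rewrite -defG y1 cycle1 joingG1.
apply: contra (small x x2) => /eqP xy.
by rewrite -defG -xy /joing finset.setUid genGid.
Qed.

End Involutions.

Local Open Scope classical_set_scope.

Theorem theorem13 (R : realType) (n : nat) (hn : (2 <= n)%N)
    (alpha : set (sphere R)) (alpha_fin : finite_set alpha)
    (alpha_card : (4 <= #|` fset_set alpha|)%N) :
  stab alpha = generated_subgroup [set rotation R n] <->
  [/\ is_union_of (rot_blocks n) alpha,
      (forall p : nat, (2 <= p)%N ->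
         ~ is_union_of (rot_blocks (p * n)) alpha)
    & ~ [\/ iso_to (stab alpha) ('Alt_('I_5))%G,
            iso_to (stab alpha) ('Sym_('I_4))%G,
            iso_to (stab alpha) ('Alt_('I_4))%G
          | exists2 k : nat, (2 <= k)%N & iso_to (stab alpha) (dihedral k)]].
Proof.
have n0 : (0 < n)%N := ltnW hn.
have stabX g k : stab alpha g -> stab alpha (g ^+ k)%g.
  move=> sg; elim: k => [|k IH]; first by rewrite expg0; exact: stab1.
  by rewrite expgS; apply: stabM.
split=> [sE|[/union_of_rot_blocks sr np niso]].
  have sr : stab alpha (rotation R n).
    rewrite sE; apply/mem_generated_rotation => //.
    by exists 1%N; rewrite expg1.
  split; first exact/union_of_rot_blocks.
    move=> p p2 /union_of_rot_blocks.
    rewrite sE => /(mem_generated_rotation _ n0)[k e].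
    have : (rotation R (p * n) ^+ n = 1)%g.
      by rewrite e -expgM mulnC expgM rotationX_order // expg1n.
    move/(rotationX_eq1 (_ : 0 < p * n)%N) => h; have := dvdn_leq n0 (h _); nia.
  rewrite sE => h.
  have [x [y [Ax Ay [x1 y1] [xx yy] /eqP xy]]] :=
    two_even_involutions (isT : 4 <= 4)%N.
  have [x' [y' [Ax' Ay' [x1' y1'] [xx' yy'] /eqP xy']]] :=
    two_even_involutions (isT : 4 <= 5)%N.
  case: h => [iso|iso|iso|[k k2 iso]].
  - by apply: xy'; apply: (iso_to_generated_involutions n0 iso).
  - apply: xy.
    by apply: (iso_to_generated_involutions n0 iso) => //; rewrite inE.
  - by apply: xy; apply: (iso_to_generated_involutions n0 iso).
  have [u [v [u1 v1 uu vv /eqP uv]]] := two_dihedral_involutions k2.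
  by apply: uv; apply: (iso_to_generated_involutions n0 iso) => //; rewrite inE.
have [A eA] := stab_fin_lft_group alpha_fin (ltnW alpha_card).
have memA h : h \in lft_fset A <-> stab alpha h by rewrite -eA.
have rA : rotation R n \in lft_fset A by apply/memA.
have [cycA|H] := fin_lft_classification A; last first.
  case: niso; rewrite -eA; case: H => [iso|iso|iso|[k k2 iso]].
  - by constructor 1; apply: isog_iso_to.
  - by constructor 2; apply: isog_iso_to.
  - by constructor 3; apply: isog_iso_to.
  by constructor 4; exists k => //; apply: isog_iso_to.
have rm := cyclic_rotation_mem hn rA cycA; have /memA srm := rm.
have /dvdnP[p mE] := cyclic_rotation_dvd hn rA.
have m0 := cardG_gt0 [set: lft_elt A]%SET.
have p1 : p = 1%N.
  have [p2|p2] := leqP 2 p; last by move: m0; rewrite mE muln_gt0; lia.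
  by case: (np p p2); apply/union_of_rot_blocks; rewrite -mE.
apply/seteqP; split=> h; last first.
  by move/(mem_generated_rotation _ n0)=> [k ->]; apply: stabX.
move/memA => hA; apply/(mem_generated_rotation _ n0).
have [k e] := cyclic_rotationX hn rA cycA [` hA]%fset; exists k.
by rewrite -[h]/(val ([` hA]%fset : lft_elt A)) e mE p1 mul1n.
Qed.
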